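(* Let $p:\mathbb{R}^{d_x}\to\mathbb{R}$ be convex and $L_p$-smooth, let $q:\mathbb{R}^{d_y}\to\mathbb{R}$ be convex and $L_q$-smooth, and let $R:\mathbb{R}^{d_x}\times\mathbb{R}^{d_y}\to\mathbb{R}$ be $L_R$-smooth, $\mu_x$-strongly convex in $x$ for every fixed $y$ and $\mu_y$-strongly concave in $y$ for every fixed $x$ ($\mu_x,\mu_y>0$). Let $(x^*,y^* )$ be the solution of $\min_{x}\max_{y}\, p(x)+R(x,y)-q(y)$. Run Algorithm 1 (described in the context) with the following parameters: if $\frac{L_p}{\mu_x}>\frac{L_q}{\mu_y}$, $$\alpha=\min\left\{1,\sqrt{\tfrac{\mu_x}{L_p}}\right\},\quad \eta_x=\min\left\{\tfrac{1}{3\mu_x},\tfrac{1}{3L_p\alpha}\right\},\quad \eta_y=\tfrac{\mu_x}{\mu_y}\eta_x,$$ and if $\frac{L_q}{\mu_y}>\frac{L_p}{\mu_x}$, $$\alpha=\min\left\{1,\sqrt{\tfrac{\mu_y}{L_q}}\right\},\quad \eta_y=\min\left\{\tfrac{1}{3\mu_y},\tfrac{1}{3L_q\alpha}\right\},\quad \eta_x=\tfrac{\mu_y}{\mu_x}\eta_y.$$ Suppose that at every iteration $k$ the approximate solution $(\hat x^{k+1},\hat y^{k+1})$ of the auxiliary problem satisfies $$\eta_x\|\nabla_x A_\eta^k(\hat x^{k+1},\hat y^{k+1})\|^2+\eta_y\|\nabla_y A_\eta^k(\hat x^{k+1},\hat y^{k+1})\|^2\le \frac{1}{6\eta_x}\|\hat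 x^{k+1}-x^k\|^2+\frac{1}{6\eta_y}\|\hat y^{k+1}-y^k\|^2 .$$ Then for every $\varepsilon>0$ and every $$K\ge 3\max\left\{1,\sqrt{\tfrac{L_p}{\mu_x}},\sqrt{\tfrac{L_q}{\mu_y}}\right\}\log\frac{\frac{1}{\eta_x}\|x^0-x^*\|^2+\frac{1}{\eta_y}\|y^0-y^*\|^2+\frac{2}{\alpha}\mathrm{D}_p(x_f^0,x^* )+\frac{2}{\alpha}\mathrm{D}_q(y_f^0,y^* )}{\varepsilon}$$ one has $$\frac{1}{\eta_x}\|x^K-x^*\|^2+\frac{1}{\eta_y}\|y^K-y^*\|^2\le\varepsilon .$$
   Context: $\|\cdot\|$ is the Euclidean norm. A function is $L$-smooth if its gradient is $L$-Lipschitz (for $R$, jointly in $(x,y)$). A differentiable $f$ is $\mu$-strongly convex if $f(y)\ge f(x)+\langle\nabla f(x),y-x\rangle+\frac{\mu}{2}\|x-y\|^2$ for all $x,y$; $f$ is $\mu$-strongly concave if $-f$ is $\mu$-strongly convex. $\mathrm{D}_f(x,y)=f(x)-f(y)-\langle\nabla f(y),x-y\rangle$ is the Bregman divergence. Algorithm 1. Input: $x^0=x_f^0\in\mathbb{R}^{d_x}$, $y^0=y_f^0\in\mathbb{R}^{d_y}$; parameters $\alpha,\eta_x,\eta_y$. For $k=0,1,\dots,K-1$: (1) $x_g^k=\alpha x^k+(1-\alpha)x_f^k$, $\;y_g^k=\alpha y^k+(1-\alpha)y_f^k$; (2) compute an approximate solution $(\hat x^{k+1},\hat y^{k+1})$ of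 the auxiliary problem $\min_{x}\max_{y}A_\eta^k(x,y)$, where $$A_\eta^k(x,y)=\langle\nabla p(x_g^k),x\rangle+\tfrac{1}{2\eta_x}\|x-x^k\|^2+R(x,y)-\langle\nabla q(y_g^k),y\rangle-\tfrac{1}{2\eta_y}\|y-y^k\|^2;$$ (3) $x^{k+1}=x^k-\eta_x\left(\nabla p(x_g^k)+\nabla_xR(\hat x^{k+1},\hat y^{k+1})\right)$, $\;y^{k+1}=y^k-\eta_y\left(\nabla q(y_g^k)-\nabla_yR(\hat x^{k+1},\hat y^{k+1})\right)$; (4) $x_f^{k+1}=x_g^k+\alpha(\hat x^{k+1}-x^k)$, $\;y_f^{k+1}=y_g^k+\alpha(\hat y^{k+1}-y^k)$. Output: $x^K,y^K$. *)

(* Defs.v *)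
From mathcomp Require Import all_boot all_order all_algebra.
From mathcomp Require Import all_classical all_reals all_analysis.

Set Implicit Arguments.
Unset Strict Implicit.
Unset Printing Implicit Defensive.
Import Order.TTheory GRing.Theory Num.Theory.
Import numFieldNormedType.Exports.
Local Open Scope classical_set_scope.
Local Open Scope ring_scope.

Definition dot (R : realType) (n : nat) (u v : 'rV[R]_n) : R :=
  (u *m v^T) 0 0.

(* The library norm on matrices is the sup norm, hence a separate Euclidean
   norm; the notion of differentiability is the same for both. *)
Definition enorm (R : realType) (n : nat) (u : 'rV[R]_n) : R :=
  Num.sqrt (dot u u).

Definition grad (R : realType) (n : nat) (f : 'rV[R]_n -> R) (x : 'rV[R]_n) :
    'rV[R]_n :=
  \row_(i < n) 'D_(delta_mx 0 i) f x.

(* 0 <= L is automatic for n > 0: it only excludes negative Lipschitz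
   constants on the one-point space 'rV_0. *)
Definition smooth (R : realType) (n : nat) (L : R) (f : 'rV[R]_n -> R) : Prop :=
  [/\ 0 <= L,
      (forall x, differentiable f x) &
      forall x y, enorm (grad f x - grad f y) <= L * enorm (x - y)].

(* A function of two vectors, seen as a function on R^(m + n), so that [smooth]
   applies to it jointly in both variables. *)
Definition joint (R : realType) (m n : nat) (f : 'rV[R]_m -> 'rV[R]_n -> R)
    (z : 'rV[R]_(m + n)) : R :=
  f (lsubmx z) (rsubmx z).

Definition grad_x (R : realType) (m n : nat) (f : 'rV[R]_m -> 'rV[R]_n -> R)
    (x : 'rV[R]_m) (y : 'rV[R]_n) : 'rV[R]_m :=
  grad (fun x' => f x' y) x.

Definition grad_y (R : realType) (m n : nat) (f : 'rV[R]_m -> 'rV[R]_n -> R)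
    (x : 'rV[R]_m) (y : 'rV[R]_n) : 'rV[R]_n :=
  grad (fun y' => f x y') y.

Definition strongly_convex (R : realType) (n : nat) (mu : R)
    (f : 'rV[R]_n -> R) : Prop :=
  (forall x, differentiable f x) /\
  (forall x y,
     f y >= f x + dot (grad f x) (y - x) + mu / 2 * enorm (x - y) ^+ 2).

Definition strongly_concave (R : realType) (n : nat) (mu : R)
    (f : 'rV[R]_n -> R) : Prop :=
  strongly_convex mu (fun x => - f x).

Definition bregman (R : realType) (n : nat) (f : 'rV[R]_n -> R)
    (x y : 'rV[R]_n) : R :=
  f x - f y - dot (grad f y) (x - y).

(* xs minimizes x |-> max_y F x y and ys attains max_y F xs y; the inner
   maximum is the supremum in the extended reals. *)
Definition minmax_solution (R : realType) (m n : nat)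
    (F : 'rV[R]_m -> 'rV[R]_n -> R) (xs : 'rV[R]_m) (ys : 'rV[R]_n) : Prop :=
  let phi x := ereal_sup (range (fun y => (F x y)%:E)) in
  (forall x, (phi xs <= phi x)%E) /\ (forall y, F xs y <= F xs ys).

Record state (R : realType) (m n : nat) := State {
  st_x : 'rV[R]_m;
  st_y : 'rV[R]_n;
  st_xf : 'rV[R]_m;
  st_yf : 'rV[R]_n }.

Definition st_xg (R : realType) (m n : nat) (alpha : R) (s : state R m n) :
    'rV[R]_m :=
  alpha *: st_x s + (1 - alpha) *: st_xf s.

Definition st_yg (R : realType) (m n : nat) (alpha : R) (s : state R m n) :
    'rV[R]_n :=
  alpha *: st_y s + (1 - alpha) *: st_yf s.

Definition aux_fun (R : realType) (m n : nat)
    (p : 'rV[R]_m -> R) (q : 'rV[R]_n -> R) (r : 'rV[R]_m -> 'rV[R]_n -> R)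
    (alpha eta_x eta_y : R) (s : state R m n)
    (x : 'rV[R]_m) (y : 'rV[R]_n) : R :=
  dot (grad p (st_xg alpha s)) x + 1 / (2 * eta_x) * enorm (x - st_x s) ^+ 2
  + r x y
  - dot (grad q (st_yg alpha s)) y - 1 / (2 * eta_y) * enorm (y - st_y s) ^+ 2.

Definition alg_step (R : realType) (m n : nat)
    (p : 'rV[R]_m -> R) (q : 'rV[R]_n -> R) (r : 'rV[R]_m -> 'rV[R]_n -> R)
    (alpha eta_x eta_y : R) (s : state R m n)
    (xh : 'rV[R]_m) (yh : 'rV[R]_n) : state R m n :=
  let xg := st_xg alpha s in
  let yg := st_yg alpha s in
  {| st_x := st_x s - eta_x *: (grad p xg + grad_x r xh yh);
     st_y := st_y s - eta_y *: (grad q yg - grad_y r xh yh);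
     st_xf := xg + alpha *: (xh - st_x s);
     st_yf := yg + alpha *: (yh - st_y s) |}.

(* The approximate solutions of the auxiliary problems are the arbitrary
   sequences xh, yh; iteration k uses xh k.+1 and yh k.+1. *)
Fixpoint alg_iter (R : realType) (m n : nat)
    (p : 'rV[R]_m -> R) (q : 'rV[R]_n -> R) (r : 'rV[R]_m -> 'rV[R]_n -> R)
    (alpha eta_x eta_y : R) (x0 : 'rV[R]_m) (y0 : 'rV[R]_n)
    (xh : nat -> 'rV[R]_m) (yh : nat -> 'rV[R]_n) (k : nat) : state R m n :=
  if k is k'.+1 then
    alg_step p q r alpha eta_x eta_y
      (alg_iter p q r alpha eta_x eta_y x0 y0 xh yh k') (xh k'.+1) (yh k'.+1)
  else {| st_x := x0; st_y := y0; st_xf := x0; st_yf := y0 |}.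

(* Main.v *)
(* Each iteration contracts the Lyapunov function
   |x - xs|^2 / eta_x + |y - ys|^2 / eta_y + (2 / alpha) (D_p(xf, xs) + D_q(yf, ys))
   by the factor exp (- alpha / 3).  The parameters are such that
   mu_x eta_x = mu_y eta_y = alpha / 3, while Lp alpha eta_x and Lq alpha eta_y are
   at most 1 / 3.  The distance x^{k+1} - xh is - eta_x grad_x A(xh, yh), so the
   inexactness criterion absorbs the error of the auxiliary solution; strong
   monotonicity of (grad_x R, - grad_y R) and the stationarity of (xs, ys) give
   - 2 mu_x |xh - xs|^2 - 2 mu_y |yh - ys|^2, which Young's inequality trades for a
   multiple of |x - xs|^2 and |y - ys|^2.  Young's inequality yields the factor
   1 - 2 alpha / (3 + 4 alpha) on the distances, which is larger than
   1 - alpha / 3 for alpha > 3 / 4 but still at most exp (- alpha / 3). *)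

Require Import Defs.
From mathcomp Require Import all_boot all_order all_algebra.
From mathcomp Require Import all_classical all_reals all_analysis.
From mathcomp Require Import ring lra.
Import Order.TTheory GRing.Theory Num.Theory.
Import numFieldNormedType.Exports.
Local Open Scope classical_set_scope.
Local Open Scope ring_scope.

(** * Euclidean inner product and the Cauchy-Schwarz inequality *)

Section Dot.
Context {R : realType} {n : nat}.
Implicit Types (u v w : 'rV[R]_n) (a : R).

Lemma dotE u v : dot u v = \sum_i u 0 i * v 0 i.
Proof. by rewrite /dot mxE; apply: eq_bigr => i _; rewrite mxE. Qed.

Lemma dotC u v : dot u v = dot v u.
Proof. by rewrite !dotE; apply: eq_bigr => i _; rewrite mulrC. Qed.

Lemma dotDl u v w : dot (u + v) w = dot u w + dot v w.
Proof. by rewrite /dot mulmxDl mxE. Qed.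

Lemma dotZl a u v : dot (a *: u) v = a * dot u v.
Proof. by rewrite /dot -scalemxAl mxE. Qed.

Lemma dotNl u v : dot (- u) v = - dot u v.
Proof. by rewrite /dot mulNmx mxE. Qed.

Lemma dotDr u v w : dot w (u + v) = dot w u + dot w v.
Proof. by rewrite ![dot w _]dotC dotDl. Qed.

Lemma dotZr a u v : dot u (a *: v) = a * dot u v.
Proof. by rewrite dotC dotZl dotC. Qed.

Lemma dotNr u v : dot u (- v) = - dot u v.
Proof. by rewrite dotC dotNl dotC. Qed.

Definition dot_lin := (dotDl, dotDr, dotNl, dotNr, dotZl, dotZr).

Lemma dot_delta u i : dot u (delta_mx 0 i) = u 0 i.
Proof.
rewrite dotE (bigD1 i)//= mxE !eqxx mulr1 big1 ?addr0// => j ji.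
by rewrite mxE (negbTE ji) andbF mulr0.
Qed.

Lemma dot_ge0 u : 0 <= dot u u.
Proof. by rewrite dotE sumr_ge0// => i _; rewrite -expr2 sqr_ge0. Qed.

Lemma dot_eq0 u : dot u u = 0 -> u = 0.
Proof.
rewrite dotE => /psumr_eq0P u0; apply/rowP => i; rewrite mxE.
apply/eqP; rewrite -sqrf_eq0 expr2; apply/eqP; apply: u0 => // j _.
by rewrite -expr2 sqr_ge0.
Qed.

Lemma sqr_enorm u : enorm u ^+ 2 = dot u u.
Proof. by rewrite /enorm sqr_sqrtr ?dot_ge0. Qed.

Lemma enorm_ge0 u : 0 <= enorm u.
Proof. exact: sqrtr_ge0. Qed.

Lemma enormN u : enorm (- u) = enorm u.
Proof. by rewrite /enorm !dot_lin opprK. Qed.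

Lemma enormZ a u : 0 <= a -> enorm (a *: u) = a * enorm u.
Proof.
move=> a0; rewrite /enorm !dot_lin mulrA -expr2 sqrtrM ?sqr_ge0//.
by rewrite sqrtr_sqr ger0_norm.
Qed.

(** Cauchy-Schwarz: the square of [enorm v *: u - enorm u *: v] expands with the common factor
    [2 * enorm u * enorm v]. Zero norms are treated first so that this factor can be cancelled. *)
Lemma dot_le_enorm u v : dot u v <= enorm u * enorm v.
Proof.
have [v0|v0] := eqVneq (enorm v) 0.
  have /dot_eq0 -> : dot v v = 0 by rewrite -sqr_enorm v0 expr0n.
  by rewrite -(scale0r 0) dotZr mul0r mulr_ge0 ?enorm_ge0.
have vp : 0 < enorm v by rewrite lt0r v0 enorm_ge0.
have [u0|u0] := eqVneq (enorm u) 0.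
  have /dot_eq0 -> : dot u u = 0 by rewrite -sqr_enorm u0 expr0n.
  by rewrite -(scale0r 0) dotZl mul0r mulr_ge0 ?enorm_ge0.
have up : 0 < enorm u by rewrite lt0r u0 enorm_ge0.
have := dot_ge0 (enorm v *: u - enorm u *: v).
rewrite !dot_lin [dot v u]dotC -!sqr_enorm => H.
have : 0 <= 2 * enorm u * enorm v * (enorm u * enorm v - dot u v).
  by move: H; congr (_ <= _); ring.
by rewrite pmulr_rge0 ?subr_ge0// !mulr_gt0.
Qed.

End Dot.

(** * Directional derivatives, first-order convexity and the descent lemma *)

Section Gradient.
Context {R : realType} {n : nat}.
Implicit Types (f : 'rV[R]_n -> R) (x v : 'rV[R]_n).

Lemma derive_grad f x v : differentiable f x -> 'D_v f x = dot (grad f x) v.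
Proof.
move=> df; rewrite deriveE// {1}(row_sum_delta v) linear_sum dotE.
by apply: eq_bigr => i _; rewrite linearZ mxE deriveE//= mulrC.
Qed.

Lemma cvg_affine0 (c d : R) : c + h * d @[h --> (0:R)] --> c.
Proof.
have : c + h * d @[h --> (0:R)] --> c + 0 * d.
  by apply: cvgD; [exact: cvg_cst|apply: cvgM; [exact: cvg_id|exact: cvg_cst]].
by rewrite mul0r addr0.
Qed.

(** The difference quotients in [s] and along [v] are the same function of [h], so no chain rule is
    involved. *)
Lemma is_derive_line f x v (t : R) : differentiable f (x + t *: v) ->
  is_derive t 1 (fun s : R => f (x + s *: v)) (dot (grad f (x + t *: v)) v).
Proof.
move=> df; rewrite -derive_grad//.
have E : (fun h : R => h^-1 *: (((fun s : R => f (x + s *: v)) \o shift t) (h *: 1)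
      - f (x + t *: v))) =
    (fun h : R => h^-1 *: ((f \o shift (x + t *: v)) (h *: v) - f (x + t *: v))).
  apply/funext => h /=; rewrite [h *: 1]mulr1 scalerDl.
  by rewrite [_ + t *: v]addrC addrA [h *: v + _]addrC.
have : derivable f (x + t *: v) v by exact: diff_derivable.
by move=> dv; apply: DeriveDef; rewrite /derivable/derive E.
Qed.

Lemma is_derive_quad f x v c d :
  (forall h, f (h *: v + x) = f x + h * c + h ^+ 2 * d) -> is_derive x v f c.
Proof.
move=> fE.
have H : h^-1 *: ((f \o shift x) (h *: v) - f x) @[h --> 0^'] --> c.
  apply: (@cvg_trans _ (c + h * d @[h --> (0:R)^'])).
    apply: near_eq_cvg; near=> h.
    have h0 : h != 0 by near: h; exact: nbhs_dnbhs_neq.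
    by rewrite /= fE /GRing.scale/=; field.
  by apply: cvg_trans (cvg_affine0 c d); apply: cvg_app; exact: cvg_within.
by apply: DeriveDef; [apply: cvgP H|apply: cvg_lim H].
Unshelve. all: by end_near. Qed.

(** A derivative is also the limit of the quotients from the right, so small positive [t] suffice,
    and the slack [d] vanishes in the limit. With [d = 0] this yields the gradient inequality for
    convex functions; a general [d] serves minima known only up to a quadratic error. *)
Lemma derive_le_quad f x v c d : derivable f x v ->
  (forall t, 0 < t < 1 -> f (t *: v + x) - f x <= t * c + t ^+ 2 * d) ->
  'D_v f x <= c.
Proof.
move=> /cvg_dnbhs_at_right df fle.
have cd : c + h * d @[h --> (0:R)^'+] --> c.
  by apply: cvg_trans (cvg_affine0 c d); apply: cvg_app; exact: cvg_within.
apply: (ler_cvg_to df cd).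
near=> t; rewrite /GRing.scale/=.
have t0 : 0 < t by near: t; exact: nbhs_right_gt.
have t1 : t < 1 by near: t; exact: nbhs_right_lt.
rewrite mulrC ler_pdivrMr//.
have := fle t; rewrite t0 t1 => /(_ isT) /le_trans; apply.
by rewrite le_eqVlt; apply/orP; left; apply/eqP; ring.
Unshelve. all: by end_near. Qed.

Lemma convex_grad_le f x y : convex_function setT f -> differentiable f x ->
  f x + dot (grad f x) (y - x) <= f y.
Proof.
move=> cf df; rewrite -lerBrDl -derive_grad//.
apply: (@derive_le_quad _ _ _ _ 0); first exact: diff_derivable.
move=> t /andP[t0 t1]; rewrite mulr0 addr0.
have t01 : 0 <= t <= 1 by rewrite !ltW.
have := cf (Itv01 (ltW t0) (ltW t1)) y x; rewrite !inE => /(_ I I).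
rewrite convRE/= /conv/= /unstable.onem.
have -> : t *: (y - x) + x = t *: y + (1 - t) *: x.
  by rewrite scalerBr scalerBl scale1r addrAC -addrA.
lra.
Qed.

Lemma smooth_descent f L x v : smooth L f ->
  f (x + v) <= f x + dot (grad f x) v + L / 2 * dot v v.
Proof.
case=> L0 df lf.
(* Up to the constant [f x], [g] is [f] on the segment minus the claimed upper bound. Cauchy-Schwarz
   and the Lipschitz gradient make its derivative nonpositive on the unit interval, and [g 1 <= g 0]
   is the claim. *)
pose g (t : R) := f (x + t *: v) - t * dot (grad f x) v - t ^+ 2 * (L / 2 * dot v v).
have dg (t : R) : is_derive t 1 g (dot (grad f (x + t *: v)) v - dot (grad f x) v
             - 2 * t * (L / 2 * dot v v)).
  pose a := dot (grad f x) v; pose b := L / 2 * dot v v.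
  have -> : g = (fun s : R => f (x + s *: v)) - (a \*: id) - (b \*: (fun s : R => s ^+ 2)).
    by apply/funext => s; rewrite /g !fctE; congr (_ - _ - _); exact: mulrC.
  have := is_derive_line _ _ _ _ (df (x + t *: v)) => ?.
  apply: is_derive_eq.
  transitivity (dot (grad f (x + t *: v)) v - a * 1 - b * (t * 1 + t * 1)) => //.
  rewrite /a /b; ring.
have gn : g 1 <= g 0.
  apply: (@ler0_derive1_nincr _ g 0 1) => //.
  - move=> t; rewrite in_itv/= => /andP[t0 t1]; rewrite derive1E derive_val.
    have := dot_le_enorm (grad f (x + t *: v) - grad f x) v.
    have := ler_wpM2r (enorm_ge0 v) (lf (x + t *: v) x).
    rewrite [x + _]addrC addrK (enormZ _ _ (ltW t0)) !dot_lin -!sqr_enorm; lra.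
  - by apply: derivable_within_continuous => t _.
move: gn; rewrite /g !scale1r scale0r addr0 expr0n expr1n /=; lra.
Qed.

End Gradient.

(** * First-order conditions and partial gradients *)

Section Stationarity.
Context {R : realType}.

Lemma gradD n (f g : 'rV[R]_n -> R) x :
  differentiable f x -> differentiable g x ->
  grad (fun z => f z + g z) x = grad f x + grad g x.
Proof.
move=> df dg; apply/rowP => i; rewrite !mxE.
by apply: deriveD; exact: diff_derivable.
Qed.

Lemma gradN n (f : 'rV[R]_n -> R) x :
  differentiable f x -> grad (fun z => - f z) x = - grad f x.
Proof.
move=> df; apply/rowP => i; rewrite !mxE.
by apply: deriveN; exact: diff_derivable.
Qed.

(** A step [t] along [- grad f x] decreases [f] by [t * dot (grad f x) (grad f x)] to first order,
    which an error of order [t ^+ 2] cannot compensate unless the gradient is zero. *)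
Lemma grad_quad_min n (f : 'rV[R]_n -> R) x c : differentiable f x ->
  (forall z, f x <= f z + c * dot (z - x) (z - x)) -> grad f x = 0.
Proof.
move=> df fx; apply: dot_eq0; apply: le_anti; rewrite dot_ge0 andbT.
have dNf := @differentiableN _ _ _ _ _ df.
have := @derive_le_quad _ _ (- f) x (- grad f x) 0
  (c * dot (grad f x) (grad f x)) (diff_derivable dNf).
rewrite deriveN; last exact: diff_derivable.
rewrite derive_grad// dotNr (opprK (dot _ _)); apply => t _.
have := fx (t *: (- grad f x) + x); rewrite addrK !dot_lin => fxt.
rewrite -[X in X <= _]/(- f (t *: (- grad f x) + x) - - f x); lra.
Qed.

Section Joint.
Context {m n : nat} (r : 'rV[R]_m -> 'rV[R]_n -> R).

Lemma grad_y_joint x y : rsubmx (grad (joint r) (row_mx x y)) = grad_y r x y.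
Proof.
apply/rowP => j; rewrite !mxE.
have E : (fun h : R => h^-1 *: ((joint r \o shift (row_mx x y))
      (h *: delta_mx 0 (rshift m j)) - joint r (row_mx x y))) =
    (fun h : R => h^-1 *: (((fun y' => r x y') \o shift y) (h *: delta_mx 0 j)
      - r x y)).
  apply/funext => h /=; rewrite /joint !linearD/= !linearZ/= row_mxKl row_mxKr.
  have -> : lsubmx (delta_mx 0 (rshift m j)) = 0 :> 'rV[R]_m.
    by apply/rowP => i; rewrite !mxE eq_lrshift andbF.
  have -> : rsubmx (delta_mx 0 (rshift m j)) = delta_mx 0 j :> 'rV[R]_n.
    by apply/rowP => i; rewrite !mxE eq_rshift.
  by rewrite scaler0 add0r.
by rewrite /derive E.
Qed.

Lemma dot_row_mx (x x' : 'rV[R]_m) (y y' : 'rV[R]_n) :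
  dot (row_mx x y) (row_mx x' y') = dot x x' + dot y y'.
Proof.
rewrite !dotE big_split_ord/=.
by congr (_ + _); apply: eq_bigr => i _; rewrite !(row_mxEl, row_mxEr).
Qed.

(** When only [x] moves, the joint points differ by [row_mx (x - x') 0]; dropping the x-block of the
    gradient difference can only shorten it. *)
Lemma smooth_joint_grad_y L x x' y : smooth L (joint r) ->
  dot (grad_y r x y - grad_y r x' y) (grad_y r x y - grad_y r x' y)
    <= L ^+ 2 * dot (x - x') (x - x').
Proof.
case=> L0 _ /(_ (row_mx x y) (row_mx x' y)).
rewrite -(@ler_pXn2r _ 2)// ?nnegrE ?mulr_ge0 ?enorm_ge0//.
rewrite exprMn !sqr_enorm opp_row_mx add_row_mx subrr.
have d0 : dot (0 : 'rV[R]_n) 0 = 0 by rewrite dotE big1// => i _; rewrite mxE mul0r.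
rewrite (dot_row_mx (x - x')) d0 addr0.
apply: le_trans.
rewrite -!grad_y_joint -linearB/=; set u := grad _ _ - _.
by rewrite -{3 4}[u]hsubmxK dot_row_mx lerDr dot_ge0.
Qed.

End Joint.

(** * Optimality conditions of the min-max problem and strong monotonicity *)

Section Minmax.
Context {m n : nat} {r : 'rV[R]_m -> 'rV[R]_n -> R}.
Context {p : 'rV[R]_m -> R} {q : 'rV[R]_n -> R} {L mu : R}.
Hypotheses (dp : forall x, differentiable p x) (dq : forall y, differentiable q y).
Hypothesis cq : convex_function setT q.
Hypothesis drx : forall x y, differentiable (fun x => r x y) x.
Hypothesis scr : forall x, strongly_concave mu (fun y => r x y).
Hypotheses (mu_gt0 : 0 < mu) (smr : smooth L (joint r)).
Context {xs : 'rV[R]_m} {ys : 'rV[R]_n}.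
Hypothesis sol : minmax_solution (fun x y => p x + r x y - q y) xs ys.

Lemma concave_diff x y : differentiable (fun y => r x y) y.
Proof.
have [/(_ y) /(@differentiableN _ _ _ _ _)] := scr x.
rewrite (_ : - (fun y => - r x y) = (fun y => r x y))//.
by apply/funext => z; rewrite fctE opprK.
Qed.

Lemma concave_grad_ge x y y' : r x y' <=
  r x y + dot (grad_y r x y) (y' - y) - mu / 2 * dot (y' - y) (y' - y).
Proof.
have [_ /(_ y y')] := scr x; rewrite gradN; last exact: concave_diff.
rewrite -[y - y']opprB enormN sqr_enorm dotNl /grad_y; lra.
Qed.

Lemma minmax_grad_y : grad_y r xs ys = grad q ys.
Proof.
have [_ ymax] := sol.
apply/esym/eqP; rewrite -subr_eq0; apply/eqP.
rewrite /grad_y -gradN -?gradD//; last 2 first.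
- exact: (differentiableN (concave_diff _ _)).
- exact: concave_diff.
(* No error term here: [ys] is an exact minimizer of [q] minus [r xs]. *)
apply: (@grad_quad_min _ _ _ 0).
  by apply: differentiableD => //; exact: (differentiableN (concave_diff _ _)).
by move=> z; have := ymax z; lra.
Qed.

(* Strong concavity in [y] makes the partial maximum at most quadratically
   larger than [F x ys] near [xs], so [xs] is stationary for [F _ ys] itself:
   no minimax theorem is needed. *)
Lemma minmax_grad_x : grad_x r xs ys = - grad p xs.
Proof.
have [xmin ymax] := sol.
apply/eqP; rewrite -addr_eq0 addrC; apply/eqP.
rewrite /grad_x -gradD//.
apply: (@grad_quad_min _ _ _ (L ^+ 2 / (2 * mu))); first exact: differentiableD.
move=> x.
suff : p xs + r xs ys - q ys
    <= p x + r x ys - q ys + L ^+ 2 / (2 * mu) * dot (x - xs) (x - xs) by lra.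
rewrite -lee_fin.
apply: le_trans (le_trans (xmin x) _).
  by apply: ereal_sup_ubound; exists ys.
apply: ge_ereal_sup => _ [y _ <-]; rewrite lee_fin.
have h1 := concave_grad_ge x ys y.
have h2 := convex_grad_le _ ys y cq (dq ys).
have h3 := smooth_joint_grad_y r L x xs ys smr.
have [d dE] : {d | d = grad_y r x ys - grad_y r xs ys} by eexists.
rewrite -dE in h3.
(* Completing the square bounds [dot d w - mu / 2 * dot w w], with [w = y - ys], by
   [dot d d / (2 * mu)]. This is the whole gain from varying [y]: since
   [grad_y r xs ys = grad q ys], the convexity bound on [q] removes all of the linear term except
   [dot d w]. *)
have h4 := dot_ge0 (d - mu *: (y - ys)).
have h5 : 2 * mu * (dot d (y - ys) - mu / 2 * dot (y - ys) (y - ys))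
    <= L ^+ 2 * dot (x - xs) (x - xs).
  move: h4; rewrite (dotDl d) !(dotDr d) !(dotNl, dotNr, dotZl, dotZr).
  rewrite [dot (y - ys) d]dotC; lra.
have h6 : dot d (y - ys) - mu / 2 * dot (y - ys) (y - ys)
    <= L ^+ 2 / (2 * mu) * dot (x - xs) (x - xs).
  by rewrite [leRHS]mulrAC ler_pdivlMr ?mulr_gt0// mulrC.
move: h6; rewrite dE minmax_grad_y [dot (_ - grad q ys) _]dotDl dotNl; lra.
Qed.

(** In the sum of the two strong convexity and two strong concavity inequalities, the values of [r]
    at the four corners of the rectangle cancel. *)
Lemma saddle_monotone mu' x y x' y' :
  (forall y, strongly_convex mu' (fun x => r x y)) ->
  mu' * dot (x - x') (x - x') + mu * dot (y - y') (y - y')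
  <= dot (grad_x r x y - grad_x r x' y') (x - x')
     - dot (grad_y r x y - grad_y r x' y') (y - y').
Proof.
move=> scx.
have [_ /(_ x x') h1] := scx y.
have [_ /(_ x' x) h2] := scx y'.
have := concave_grad_ge x y y'; have := concave_grad_ge x' y' y.
move: h1 h2; rewrite -[x' - x]opprB -[y' - y]opprB enormN sqr_enorm.
rewrite !(dotDl (grad_x _ _ _)) !(dotDl (grad_y _ _ _)) !(dotNl, dotNr) /grad_x /grad_y; lra.
Qed.

End Minmax.
End Stationarity.

(** * Contraction factor, step sizes and one-block inequalities *)

Section Contraction.
Context {R : realType}.
Implicit Types a eta mu : R.

Lemma contraction_le_expR a : 0 <= a <= 1 ->
  1 - 2 * a / (3 + 4 * a) <= expR (- (a / 3)).
Proof.
move=> /andP[a0 a1].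
(* [expR (1 / 3) <= 7 / 5], from [1 + x <= expR x] at [x = - 1 / 96] and five
   squarings with rational rounding; convexity then bounds [expR (a / 3)] by the
   chord through [0] and [1]. *)
have e0 : 95 / 96 <= expR (- 96^-1) :> R.
  by apply: le_trans (expR_ge1Dx _); lra.
have sq c x : 0 <= c -> c <= expR x -> c ^+ 2 <= expR (2 * x) :> R.
  by move=> c0 cx; rewrite expRM_natl lerXn2r// nnegrE expR_ge0.
have e1 : 189 / 193 <= expR (- 48^-1) :> R.
  have -> : - 48^-1 = 2 * - 96^-1 :> R by field.
  by apply: le_trans (sq _ _ _ e0); lra.
have e2 : 187 / 195 <= expR (- 24^-1) :> R.
  have -> : - 24^-1 = 2 * - 48^-1 :> R by field.
  by apply: le_trans (sq _ _ _ e1); lra.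
have e3 : 183 / 199 <= expR (- 12^-1) :> R.
  have -> : - 12^-1 = 2 * - 24^-1 :> R by field.
  by apply: le_trans (sq _ _ _ e2); lra.
have e4 : 126 / 149 <= expR (- 6^-1) :> R.
  have -> : - 6^-1 = 2 * - 12^-1 :> R by field.
  by apply: le_trans (sq _ _ _ e3); lra.
have e5 : 5 / 7 <= expR (- 3^-1) :> R.
  have -> : - 3^-1 = 2 * - 6^-1 :> R by field.
  by apply: le_trans (sq _ _ _ e4); lra.
have e6 : expR 3^-1 <= 7 / 5 :> R.
  rewrite -[3^-1]opprK expRN -[7 / 5]invrK invf_div.
  by rewrite lef_pV2 ?posrE ?expR_gt0.
have e7 : expR (a / 3) <= 1 + 2 / 5 * a.
  have := convex_expR (Itv01 a0 a1) 3^-1 0; rewrite !convRE/= /unstable.onem expR0.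
  rewrite !mulr0 addr0 mulr1; nra.
have d0 : 0 < 3 + 4 * a by lra.
(* What remains is [(3 + 2 * a) * (1 + 2 / 5 * a) <= 3 + 4 * a], that is [a ^+ 2 <= a]. Equality at
   [a = 1] is why the bound [7 / 5] is aimed at. *)
rewrite expRN -[leRHS]div1r ler_pdivlMr ?expR_gt0//.
have -> : 1 - 2 * a / (3 + 4 * a) = (3 + 2 * a) / (3 + 4 * a).
  by field; rewrite gt_eqF.
rewrite mulrAC ler_pdivrMr// mul1r.
have : (3 + 2 * a) * expR (a / 3) <= (3 + 2 * a) * (1 + 2 / 5 * a).
  by rewrite ler_wpM2l//; lra.
nra.
Qed.

(** Both minima switch branch at [mu = L], so [eta = a / (3 * mu)] in either case. Writing [L] as
    [mu / s ^+ 2], with [s] the square root in [a], turns the claims into identities in [s] and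
    comparisons of [s] with 1. *)
Lemma block_params L mu a eta : 0 < mu -> 0 < L ->
  a = Num.min 1 (Num.sqrt (mu / L)) ->
  eta = Num.min (1 / (3 * mu)) (1 / (3 * L * a)) ->
  [/\ 0 < a <= 1, 0 < eta, mu * eta = a / 3, L * a * eta <= 3^-1 &
      a^-1 = Num.max 1 (Num.sqrt (L / mu))].
Proof.
move=> mu0 L0.
have s0 : 0 < Num.sqrt (mu / L) by rewrite sqrtr_gt0 divr_gt0.
have -> : Num.sqrt (L / mu) = (Num.sqrt (mu / L))^-1.
  by rewrite -sqrtrV ?invf_div// divr_ge0 ?ltW.
have sE : L = mu / Num.sqrt (mu / L) ^+ 2.
  by rewrite sqr_sqrtr ?divr_ge0 ?ltW//; field; rewrite !gt_eqF.
move: s0 sE; set s := Num.sqrt _ => s0 sE.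
have [s1|s1] := leP 1 s => -> -> {a eta}.
  have sV : s^-1 <= 1 by rewrite invf_le1.
  have Lmu : L <= mu by rewrite sE ler_pdivrMr ?exprn_gt0// ler_peMr ?(ltW mu0)//; nra.
  rewrite mulr1 min_l; last first.
    by rewrite !div1r lef_pV2 ?posrE ?mulr_gt0// ler_pM2l.
  rewrite ltr01 lexx max_l// invr1; split=> //.
  - by rewrite div1r invr_gt0 mulr_gt0.
  - by field; rewrite gt_eqF.
  - by rewrite mulr1 mul1r ler_pdivrMr ?mulr_gt0//; lra.
have -> : 1 / (3 * L * s) = s / (3 * mu).
  by rewrite sE; field; rewrite !gt_eqF.
rewrite min_r; last first.
  by rewrite ler_pM2r ?invr_gt0 ?mulr_gt0// ltW.
rewrite max_r; last by rewrite invf_ge1// ltW.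
split=> //.
- by rewrite s0 ltW.
- by rewrite divr_gt0 ?mulr_gt0.
- by field; rewrite gt_eqF.
- by rewrite {1}sE le_eqVlt; apply/orP; left; apply/eqP; field; rewrite !gt_eqF.
Qed.

(* [2a / (3 + 4a)] is half the harmonic mean of the weights [1/2], [2a/3]. *)
Lemma block_young n a (u w : 'rV[R]_n) : 0 < a ->
  2 * a / (3 + 4 * a) * dot u u
    <= 2^-1 * dot w w + 2 * a / 3 * dot (u + w) (u + w).
Proof.
move=> a0; have d0 : 0 < 3 + 4 * a by lra.
rewrite mulrAC ler_pdivrMr//.
(* This vector vanishes exactly at the [w] minimizing the right-hand side. *)
have := dot_ge0 ((3 + 4 * a) *: w + (4 * a) *: u).
rewrite !dot_lin [dot w u]dotC; nra.
Qed.

(** The square is expanded around [xh] instead of [x]. With [G] the update direction,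
    [G + eta^-1 *: (xh - x)] is, up to sign in the y-block, the gradient of the auxiliary function
    at [(xh, yh)], which the inexactness criterion controls. *)
Lemma block_update n eta (x xh xs G : 'rV[R]_n) : eta != 0 ->
  eta^-1 * dot (x - eta *: G - xs) (x - eta *: G - xs) =
  eta^-1 * dot (x - xs) (x - xs) - 2 * dot G (xh - xs)
  + eta * dot (G + eta^-1 *: (xh - x)) (G + eta^-1 *: (xh - x))
  - eta^-1 * dot (xh - x) (xh - x).
Proof.
move=> eta0.
have -> : x - eta *: G - xs = (x - xs) - eta *: G by rewrite addrAC.
have -> : xh - xs = (xh - x) + (x - xs) by rewrite addrA subrK.
move: (x - xs) (xh - x) => u w.
by rewrite !dot_lin [dot u G]dotC [dot w G]dotC; field.
Qed.

(** The acceleration estimate: descent from [xg] to the new [xf], plus convexity at [xg] against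
    [xs] with weight [a] and against [xf] with weight [1 - a]. By the choice of [xg], the
    displacements add up to [a *: (xh - xs)]. *)
Lemma block_bregman n (p : 'rV[R]_n -> R) L a (x xf xh xs : 'rV[R]_n)
    (xg := a *: x + (1 - a) *: xf) :
  convex_function setT p -> smooth L p -> 0 < a <= 1 ->
  - 2 * dot (grad p xg - grad p xs) (xh - xs)
  <= (1 - a) * (2 / a * bregman p xf xs)
     - 2 / a * bregman p (xg + a *: (xh - x)) xs + L * a * dot (xh - x) (xh - x).
Proof.
move=> cp smp /andP[a0 a1].
have [_ dp _] := smp.
have h1 := smooth_descent _ _ xg (a *: (xh - x)) smp.
have h2 := ler_wpM2l (ltW a0) (convex_grad_le _ xg xs cp (dp xg)).
have a1' : 0 <= 1 - a by rewrite subr_ge0.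
have h3 := ler_wpM2l a1' (convex_grad_le _ xg xf cp (dp xg)).
rewrite -(ler_pM2l a0).
have -> : a * ((1 - a) * (2 / a * bregman p xf xs)
     - 2 / a * bregman p (xg + a *: (xh - x)) xs + L * a * dot (xh - x) (xh - x))
  = 2 * ((1 - a) * bregman p xf xs - bregman p (xg + a *: (xh - x)) xs)
    + L * dot (a *: (xh - x)) (a *: (xh - x)).
  by rewrite [dot (a *: _) _]dotZl dotZr; field; rewrite gt_eqF.
move: h1 h2 h3; rewrite /bregman.
move: (p (xg + _)) (p xg) (p xf) (p xs) (dot (a *: (xh - x)) (a *: (xh - x))).
move=> pf' pg pf ps d h1 h2 h3.
move: (grad p xg) (grad p xs) h1 h2 h3 => g gs.
rewrite /xg !(dotDl g) !(dotDr, dotNr, dotNl, dotZr) => h1 h2 h3.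
nra.
Qed.

Lemma bregman_ge0 n (p : 'rV[R]_n -> R) x xs :
  convex_function setT p -> differentiable p xs -> 0 <= bregman p x xs.
Proof. by move=> cp dp; have := convex_grad_le _ xs x cp dp; rewrite /bregman; lra. Qed.

End Contraction.

(** * One iteration, its Lyapunov decrease and the iteration count *)

Section Step.
Context {R : realType}.

(** Only [b != 0] is asked, so that [b = - eta_y] covers the concave block; [k] collects the terms
    in the other variable. *)
Lemma grad_prox n (f : 'rV[R]_n -> R) (c a : 'rV[R]_n) b k x : b != 0 ->
  differentiable f x ->
  grad (fun z => dot c z + 1 / (2 * b) * enorm (z - a) ^+ 2 + f z + k) x
    = c + b^-1 *: (x - a) + grad f x.
Proof.
move=> b0 df; apply/rowP => i; rewrite !mxE.
pose h z := dot c z + 1 / (2 * b) * enorm (z - a) ^+ 2 + k.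
have dh : is_derive x (delta_mx 0 i) h (dot (c + b^-1 *: (x - a)) (delta_mx 0 i)).
  apply: (@is_derive_quad _ _ _ _ _ _
    ((2 * b)^-1 * dot (delta_mx 0 i : 'rV[R]_n) (delta_mx 0 i))) => t.
  rewrite /h !sqr_enorm -[_ + x - a]addrA; move: (x - a) (delta_mx _ _) => u v.
  by rewrite !dot_lin [dot v u]dotC; field.
have -> : (fun z => dot c z + 1 / (2 * b) * enorm (z - a) ^+ 2 + f z + k) = h + f.
  by apply/funext => z; rewrite fctE /h addrAC.
rewrite deriveD//; last exact: diff_derivable.
by rewrite derive_val dot_delta !mxE.
Qed.

(** The coupling enters only through [Gr], which is [grad_x r] in one block and [- grad_y r] in the
    other. The two terms left at [xh - xs] are handled by monotonicity once both blocks are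
    added. *)
Lemma block_step n (p : 'rV[R]_n -> R) L mu a eta (x xf xh xs Gr : 'rV[R]_n)
    (xg := a *: x + (1 - a) *: xf)
    (GA := grad p xg + eta^-1 *: (xh - x) + Gr) :
  convex_function setT p -> smooth L p -> 0 < a <= 1 -> 0 < eta ->
  mu * eta = a / 3 -> L * a * eta <= 3^-1 ->
  eta^-1 * dot (x - eta *: (grad p xg + Gr) - xs) (x - eta *: (grad p xg + Gr) - xs)
    + 2 / a * bregman p (xg + a *: (xh - x)) xs
  <= (1 - 2 * a / (3 + 4 * a)) * (eta^-1 * dot (x - xs) (x - xs))
    + (1 - a) * (2 / a * bregman p xf xs)
    - 2 * dot (grad p xs + Gr) (xh - xs) + 2 * mu * dot (xh - xs) (xh - xs)
    + eta * dot GA GA - (6 * eta)^-1 * dot (xh - x) (xh - x).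
Proof.
move=> cp smp a01 eta0 mueta Leta.
have /andP[a0 _] := a01.
have eta_neq0 : eta != 0 by rewrite gt_eqF.
rewrite (block_update _ _ _ xh _ _ eta_neq0).
have -> : grad p xg + Gr + eta^-1 *: (xh - x) = GA by rewrite addrAC.
have := block_bregman _ _ _ _ x xf xh xs cp smp a01; rewrite -/xg.
have ieta : 0 <= eta^-1 by rewrite invr_ge0 ltW.
(* Of the available [eta^-1 * dot (xh - x) (xh - x)], Young's inequality spends one half and the
   smoothness term one third; the remaining sixth meets the inexactness criterion. The weight
   [2 * a / 3 * eta^-1] equals [2 * mu]. *)
have := ler_wpM2l ieta (block_young _ _ (x - xs) (xh - x) a0).
have -> : (x - xs) + (xh - x) = xh - xs by rewrite addrC addrA subrK.
have muE : mu = a / 3 * eta^-1 by rewrite -mueta mulfK.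
have La : L * a * dot (xh - x) (xh - x) <= 3^-1 * eta^-1 * dot (xh - x) (xh - x).
  by rewrite ler_wpM2r ?dot_ge0// ler_pdivlMr.
rewrite [dot (_ + Gr) _]dotDl [dot (_ + Gr) _]dotDl [dot (_ - grad _ _) _]dotDl dotNl.
rewrite invfM muE; lra.
Qed.

Context {m n : nat} {p : 'rV[R]_m -> R} {q : 'rV[R]_n -> R}.
Context {r : 'rV[R]_m -> 'rV[R]_n -> R}.
Context {Lp Lq LR mu_x mu_y alpha eta_x eta_y : R}.
Context {xs : 'rV[R]_m} {ys : 'rV[R]_n}.
Hypotheses (p_convex : convex_function setT p) (p_smooth : smooth Lp p).
Hypotheses (q_convex : convex_function setT q) (q_smooth : smooth Lq q).
Hypotheses (r_smooth : smooth LR (joint r)) (mu_y_gt0 : 0 < mu_y).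
Hypothesis r_convex : forall y, strongly_convex mu_x (fun x => r x y).
Hypothesis r_concave : forall x, strongly_concave mu_y (fun y => r x y).
Hypothesis sol : minmax_solution (fun x y => p x + r x y - q y) xs ys.
Hypotheses (alpha01 : 0 < alpha <= 1) (eta_x_gt0 : 0 < eta_x) (eta_y_gt0 : 0 < eta_y).
Hypotheses (mu_eta_x : mu_x * eta_x = alpha / 3) (mu_eta_y : mu_y * eta_y = alpha / 3).
Hypotheses (Lp_eta : Lp * alpha * eta_x <= 3^-1) (Lq_eta : Lq * alpha * eta_y <= 3^-1).

Definition lyapunov (s : state R m n) : R :=
  1 / eta_x * enorm (st_x s - xs) ^+ 2 + 1 / eta_y * enorm (st_y s - ys) ^+ 2
  + 2 / alpha * bregman p (st_xf s) xs + 2 / alpha * bregman q (st_yf s) ys.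

Lemma lyapunov_ge s :
  1 / eta_x * enorm (st_x s - xs) ^+ 2 + 1 / eta_y * enorm (st_y s - ys) ^+ 2
  <= lyapunov s.
Proof.
have /andP[a0 _] := alpha01; have [_ dp _] := p_smooth; have [_ dq _] := q_smooth.
rewrite /lyapunov -addrA lerDl addr_ge0// mulr_ge0 ?divr_ge0 ?(ltW a0)//.
  exact: bregman_ge0.
exact: bregman_ge0.
Qed.

Lemma lyapunov_ge0 s : 0 <= lyapunov s.
Proof.
apply: le_trans (lyapunov_ge s).
by rewrite addr_ge0// mulr_ge0 ?sqr_ge0// divr_ge0// ltW.
Qed.

Lemma lyapunov_step s xh yh
    (A := aux_fun p q r alpha eta_x eta_y s) :
  eta_x * enorm (grad_x A xh yh) ^+ 2 + eta_y * enorm (grad_y A xh yh) ^+ 2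
    <= 1 / (6 * eta_x) * enorm (xh - st_x s) ^+ 2
       + 1 / (6 * eta_y) * enorm (yh - st_y s) ^+ 2 ->
  lyapunov (alg_step p q r alpha eta_x eta_y s xh yh)
    <= expR (- (alpha / 3)) * lyapunov s.
Proof.
have /andP[a0 a1] := alpha01; have [_ dp _] := p_smooth; have [_ dq _] := q_smooth.
have drx x y : differentiable (fun x => r x y) x by have [] := r_convex y.
have gAx : grad_x A xh yh = grad p (st_xg alpha s)
    + eta_x^-1 *: (xh - st_x s) + grad_x r xh yh.
  rewrite -(grad_prox _ (fun x => r x yh) _ _ _ (- dot (grad q (st_yg alpha s)) yh
    - 1 / (2 * eta_y) * enorm (yh - st_y s) ^+ 2)) ?gt_eqF//.
  by apply: (congr1 (fun f => grad f xh)); apply/funext => x; rewrite /A /aux_fun addrA.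
have gAy : grad_y A xh yh = - (grad q (st_yg alpha s)
    + eta_y^-1 *: (yh - st_y s) - grad_y r xh yh).
  rewrite !opprD opprK -scaleNr -invrN.
  rewrite -(grad_prox _ (fun y => r xh y) _ _ _ (dot (grad p (st_xg alpha s)) xh
    + 1 / (2 * eta_x) * enorm (xh - st_x s) ^+ 2)) ?oppr_eq0 ?gt_eqF//; last first.
    exact: concave_diff.
  apply: (congr1 (fun f => grad f yh)); apply/funext => y; rewrite /A /aux_fun dotNl mulrN invrN mulrN mulNr.
  ring.
rewrite gAx gAy enormN !sqr_enorm => inexact.
set c := expR _.
have c1 : 1 - 2 * alpha / (3 + 4 * alpha) <= c.
  by apply: contraction_le_expR; rewrite a1 ltW.
have c2 : 1 - alpha <= c by apply: le_trans (expR_ge1Dx _); lra.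
have hx := block_step _ _ _ _ _ _ (st_x s) (st_xf s) xh xs (grad_x r xh yh)
  p_convex p_smooth alpha01 eta_x_gt0 mu_eta_x Lp_eta.
have hy := block_step _ _ _ _ _ _ (st_y s) (st_yf s) yh ys (- grad_y r xh yh)
  q_convex q_smooth alpha01 eta_y_gt0 mu_eta_y Lq_eta.
(* Twice this inequality, with the stationarity conditions inserted, cancels the coupling terms of
   [hx] and [hy]. *)
have mono := saddle_monotone r_concave _ xh yh xs ys r_convex.
rewrite (minmax_grad_x dp dq q_convex drx r_concave mu_y_gt0 r_smooth sol) in mono.
rewrite (minmax_grad_y dq r_concave sol) opprK in mono.
have U_ge0 k (u : 'rV[R]_k) e : 0 < e -> 0 <= e^-1 * dot u u.
  by move=> e0; rewrite mulr_ge0 ?dot_ge0// invr_ge0 ltW.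
have kx := ler_wpM2r (U_ge0 _ (st_x s - xs) _ eta_x_gt0) c1.
have ky := ler_wpM2r (U_ge0 _ (st_y s - ys) _ eta_y_gt0) c1.
have a2 : 0 <= 2 / alpha by rewrite divr_ge0 ?ltW.
have lx := ler_wpM2r (mulr_ge0 a2 (bregman_ge0 _ _ (st_xf s) xs p_convex (dp xs))) c2.
have ly := ler_wpM2r (mulr_ge0 a2 (bregman_ge0 _ _ (st_yf s) ys q_convex (dq ys))) c2.
have dN : dot (grad q ys - grad_y r xh yh) (yh - ys)
  = - dot (grad_y r xh yh - grad q ys) (yh - ys) by rewrite -dotNl opprB.
rewrite dN in hy.
rewrite [grad_x _ _ _ + _]addrC in mono.
rewrite /lyapunov /alg_step /= !sqr_enorm !div1r.
rewrite !div1r in inexact.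
lra.
Qed.

Lemma lyapunov_iter x0 y0 xh yh K
    (st := alg_iter p q r alpha eta_x eta_y x0 y0 xh yh)
    (A := fun k => aux_fun p q r alpha eta_x eta_y (st k)) :
  (forall k, (k < K)%N ->
    eta_x * enorm (grad_x (A k) (xh k.+1) (yh k.+1)) ^+ 2
    + eta_y * enorm (grad_y (A k) (xh k.+1) (yh k.+1)) ^+ 2
    <= 1 / (6 * eta_x) * enorm (xh k.+1 - st_x (st k)) ^+ 2
       + 1 / (6 * eta_y) * enorm (yh k.+1 - st_y (st k)) ^+ 2) ->
  lyapunov (st K) <= expR (- (alpha / 3)) ^+ K * lyapunov (st 0%N).
Proof.
elim: K => [|K IH] inexact; first by rewrite expr0 mul1r.
apply: le_trans (lyapunov_step (st K) (xh K.+1) (yh K.+1) _) _.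
  exact: inexact.
rewrite exprS -mulrA ler_wpM2l ?expR_ge0// IH// => k kK.
by apply: inexact; rewrite ltnS ltnW.
Qed.

Lemma lyapunov_bound x0 y0 xh yh K eps M
    (st := alg_iter p q r alpha eta_x eta_y x0 y0 xh yh)
    (A := fun k => aux_fun p q r alpha eta_x eta_y (st k)) :
  (forall k, (k < K)%N ->
    eta_x * enorm (grad_x (A k) (xh k.+1) (yh k.+1)) ^+ 2
    + eta_y * enorm (grad_y (A k) (xh k.+1) (yh k.+1)) ^+ 2
    <= 1 / (6 * eta_x) * enorm (xh k.+1 - st_x (st k)) ^+ 2
       + 1 / (6 * eta_y) * enorm (yh k.+1 - st_y (st k)) ^+ 2) ->
  0 < eps -> alpha^-1 = M ->
  3 * M * ln (lyapunov (st 0%N) / eps) <= K%:R ->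
  lyapunov (st K) <= eps.
Proof.
move=> inexact eps0 <- KM; have /andP[a0 _] := alpha01.
apply: le_trans (lyapunov_iter _ _ _ _ _ inexact) _; rewrite -/st.
(* A zero initial value is settled directly, because the logarithm is inverted only at positive
   arguments. *)
have := lyapunov_ge0 (st 0%N); rewrite le_eqVlt => /predU1P[<-|psi0].
  by rewrite mulr0 ltW.
rewrite -expRM_natl -ler_pdivlMr// -[eps / _]invrK invf_div.
have d0 : 0 < lyapunov (st 0%N) / eps by rewrite divr_gt0.
rewrite -(lnK d0) -expRN ler_expR mulrN lerN2.
have := ler_wpM2l (ltW a0) KM; rewrite !mulrA [alpha * 3]mulrC mulfK ?gt_eqF//; lra.
Qed.

End Step.

(** * Reduction of both parameter regimes to the common bound *)

Theorem theorem1 (R : realType) (dx dy : nat)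
  (p : 'rV[R]_dx -> R) (q : 'rV[R]_dy -> R) (r : 'rV[R]_dx -> 'rV[R]_dy -> R)
  (Lp Lq LR mu_x mu_y : R)
  (p_convex : convex_function setT p) (p_smooth : smooth Lp p)
  (q_convex : convex_function setT q) (q_smooth : smooth Lq q)
  (r_smooth : smooth LR (joint r))
  (mu_x_gt0 : 0 < mu_x) (mu_y_gt0 : 0 < mu_y)
  (r_convex : forall y, strongly_convex mu_x (fun x => r x y))
  (r_concave : forall x, strongly_concave mu_y (fun y => r x y))
  (xs : 'rV[R]_dx) (ys : 'rV[R]_dy)
  (xs_ys_sol : minmax_solution (fun x y => p x + r x y - q y) xs ys)
  (alpha eta_x eta_y : R)
  (parameters :
    [/\ Lp / mu_x > Lq / mu_y,
        alpha = Num.min 1 (Num.sqrt (mu_x / Lp)),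
        eta_x = Num.min (1 / (3 * mu_x)) (1 / (3 * Lp * alpha)) &
        eta_y = mu_x / mu_y * eta_x]
    \/
    [/\ Lq / mu_y > Lp / mu_x,
        alpha = Num.min 1 (Num.sqrt (mu_y / Lq)),
        eta_y = Num.min (1 / (3 * mu_y)) (1 / (3 * Lq * alpha)) &
        eta_x = mu_y / mu_x * eta_y])
  (x0 : 'rV[R]_dx) (y0 : 'rV[R]_dy)
  (xh : nat -> 'rV[R]_dx) (yh : nat -> 'rV[R]_dy)
  (eps : R) (eps_gt0 : 0 < eps) (K : nat)
  (st := alg_iter p q r alpha eta_x eta_y x0 y0 xh yh)
  (A := fun k => aux_fun p q r alpha eta_x eta_y (st k))
  (inexact : forall k, (k < K)%N ->
    eta_x * enorm (grad_x (A k) (xh k.+1) (yh k.+1)) ^+ 2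
    + eta_y * enorm (grad_y (A k) (xh k.+1) (yh k.+1)) ^+ 2
    <= 1 / (6 * eta_x) * enorm (xh k.+1 - st_x (st k)) ^+ 2
       + 1 / (6 * eta_y) * enorm (yh k.+1 - st_y (st k)) ^+ 2)
  (K_large :
    K%:R >= 3 * Num.max 1 (Num.max (Num.sqrt (Lp / mu_x))
                                   (Num.sqrt (Lq / mu_y)))
            * ln ((1 / eta_x * enorm (x0 - xs) ^+ 2
                   + 1 / eta_y * enorm (y0 - ys) ^+ 2
                   + 2 / alpha * bregman p (st_xf (st 0%N)) xs
                   + 2 / alpha * bregman q (st_yf (st 0%N)) ys) / eps)) :
  1 / eta_x * enorm (st_x (st K) - xs) ^+ 2
  + 1 / eta_y * enorm (st_y (st K) - ys) ^+ 2 <= eps.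
Proof.
have [Lp0 _ _] := p_smooth; have [Lq0 _ _] := q_smooth.
(* The block with the smaller condition number inherits the smoothness bound, since [u * a * eta] is
   the same for both blocks. *)
have ratio Lu Lv u v (eta a : R) : 0 < u -> 0 < v -> Lv / v < Lu / u -> 0 <= a ->
    0 < eta -> Lu * a * eta <= 3^-1 -> Lv * a * (u / v * eta) <= 3^-1.
  move=> u0 v0 LL a0 eta0; apply: le_trans.
  have -> : Lv * a * (u / v * eta) = (Lv / v) * (u * a * eta) by field; rewrite gt_eqF.
  have -> : Lu * a * eta = (Lu / u) * (u * a * eta) by field; rewrite gt_eqF.
  apply: ler_wpM2r (ltW LL); rewrite mulr_ge0 ?(ltW eta0)//.
  by rewrite mulr_ge0 ?(ltW u0).
have [alpha01 eta_x_gt0 eta_y_gt0 [mu_eta_x mu_eta_y Lp_eta Lq_eta] alphaV] :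
  [/\ 0 < alpha <= 1, 0 < eta_x, 0 < eta_y,
    [/\ mu_x * eta_x = alpha / 3, mu_y * eta_y = alpha / 3, Lp * alpha * eta_x <= 3^-1
      & Lq * alpha * eta_y <= 3^-1]
    & alpha^-1 = Num.max 1 (Num.max (Num.sqrt (Lp / mu_x)) (Num.sqrt (Lq / mu_y)))].
  case: parameters => -[LL aE eE eE'].
  (* The strict comparison with a nonnegative ratio forces the dominant smoothness constant to be
     positive. *)
  - have Lp_gt0 : 0 < Lp.
      have := le_lt_trans (divr_ge0 Lq0 (ltW mu_y_gt0)) LL.
      by rewrite pmulr_lgt0// invr_gt0.
    have [a01 e0 mue Le aV] := block_params _ _ _ _ mu_x_gt0 Lp_gt0 aE eE.
    have /andP[a0 _] := a01.
    split=> //.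
    + by rewrite eE' mulr_gt0// divr_gt0.
    + split=> //; first by rewrite eE' mulrA [_ * (_ / _)]mulrCA mulfV ?gt_eqF// mulr1.
      by rewrite eE'; apply: (ratio Lp) => //; exact: ltW.
    + by rewrite aV [Num.max (Num.sqrt _) _]max_l// ler_wsqrtr// ltW.
  - have Lq_gt0 : 0 < Lq.
      have := le_lt_trans (divr_ge0 Lp0 (ltW mu_x_gt0)) LL.
      by rewrite pmulr_lgt0// invr_gt0.
    have [a01 e0 mue Le aV] := block_params _ _ _ _ mu_y_gt0 Lq_gt0 aE eE.
    have /andP[a0 _] := a01.
    split=> //.
    + by rewrite eE' mulr_gt0// divr_gt0.
    + split=> //; first by rewrite eE' mulrA [_ * (_ / _)]mulrCA mulfV ?gt_eqF// mulr1.
      by rewrite eE'; apply: (ratio Lq) => //; exact: ltW.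
    + by rewrite aV [Num.max (Num.sqrt _) _]max_r// ler_wsqrtr// ltW.
apply: le_trans (lyapunov_ge p_convex p_smooth q_convex q_smooth alpha01 (st K)) _.
exact: (lyapunov_bound p_convex p_smooth q_convex q_smooth r_smooth mu_y_gt0
  r_convex r_concave xs_ys_sol alpha01 eta_x_gt0 eta_y_gt0 mu_eta_x mu_eta_y
  Lp_eta Lq_eta _ _ _ _ _ _ _ inexact eps_gt0 alphaV K_large).
Qed.
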